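(* Let $\Delta\subset\mathbb{R}^n$ be a (compact, convex, rational) labeled polytope, $\dim\Delta=n$, that is centered at the origin. Let $M+1\ge 1$ be the number of dimension drops that occur while shrinking $\Delta$, let $k_1,\dots,k_{M+1}\geq 1$ be the amounts by which the dimension drops, and let $\mathbb{R}^n=\mathbb{R}^{k_1}\times\cdots\times\mathbb{R}^{k_{M+1}}$ be the associated orthogonal splitting. Then $\Delta$ is an intersection of (compact, convex, rational) monotone labeled polytopes in one of the following ways: there exist an integer $N\ge 0$ and compact convex rational monotone labeled polytopes $\widetilde{\Delta}^n_k\subset\mathbb{R}^n$ with $\dim\widetilde{\Delta}^n_k=n$ for every $k\in\{0,\dots,N\}$ such that, if $M=0$, $$\Delta=\bigcap_{k=0}^N \widetilde{\Delta}^n_k ,$$ and, if $M>0$, there exist in addition compact convex rational monotone labeled polytopes $\widetilde{\Delta}^{k_1+\cdots+k_j}\subset \mathbb{R}^{k_1}\times\cdots\times\mathbb{R}^{k_j}=\mathbb{R}^{k_1+\cdots+k_j}$ with $\dim\widetilde{\Delta}^{k_1+\cdots+k_j}=k_1+\cdots+k_j$ for every $j\in\{1,\dots,M\}$, such that $$\Delta=\bigcap_{k=0}^N \widetilde{\Delta}^n_k\ \cap\ \bigcap_{j=1}^M\left(\widetilde{\Delta}^{k_1+\cdots+ k_j}\times\mathbb{R}^{n-(k_1+\cdots+ k_j)}\right).$$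
   Context: Labeled polytopes. A labeled polytope in $\mathbb{R}^n$ is a compact convex rational $n$-dimensional polytope with a positive integer (label) attached to each facet. It is uniquely written as $\Delta=\bigcap_{i=1}^d\{x\in\mathbb{R}^n : \langle x,v_i\rangle\leq\lambda_i\}$, where $d$ is the number of facets, $\langle\cdot,\cdot\rangle$ is the standard inner product, $\lambda_i\in\mathbb{R}$, and $v_i=a_iw_i$ with $w_i\in\mathbb{Z}^n$ the primitive outward normal to the $i$-th facet and $a_i\in\mathbb{Z}_{>0}$ the label of that facet. It is monotone if there is $\lambda$ with $\lambda_i=\lambda$ for all $i$. (For polytopes in a subspace $V\subset\mathbb{R}^n$ occurring as a factor of the splitting below, integrality of normals is understood with respect to the lattice $V\cap\mathbb{Z}^n$.) Shrinking procedure. For $t\ge 0$ let $H_i^t=\{x\in\mathbb{R}^n:\langle x,v_i\rangle=\lambda_i-t\}$. Starting from $\Delta^0=\Delta$, put $\Delta^t=\{x:\langle x,v_i\rangle\le\lambda_i-t,\ i=1,\dots,d\}$ until the smallest time $t_1>0$ with $\dim\Delta^{t_1}=n-k_1<n$; put $\mathcal{D}_1=\{i:\Delta^{t_1}\subset H_i^{t_1}\}$. If $\Delta^{t_1}$ is a point, stop. Otherwise continue inductively: once $t_1<\dots<t_j$ and $\mathcal{D}_1,\dots,\mathcal{D}_j$ are defined and $\Delta^{t_j}$ is not a point, for $t>t_j$ put $$\Delta^t=\{x:\langle x,v_i\rangle\le\lambda_i-t \text{ for } i\notin\mathcal{D}_1\cup\dots\cup\mathcal{D}_j,\ \langle x,v_i\rangle=\lambda_i-t_s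 \text{ for } i\in\mathcal{D}_s,\ s=1,\dots,j\}$$ until the smallest time $t_{j+1}>t_j$ at which the dimension drops, by an amount denoted $k_{j+1}\ge1$; put $\mathcal{D}_{j+1}=\{i\notin\mathcal{D}_1\cup\dots\cup\mathcal{D}_j:\Delta^{t_{j+1}}\subset H_i^{t_{j+1}}\}$. The procedure ends at the time $t_{M+1}$ at which $\Delta^{t_{M+1}}$ is a single point; thus there are $M+1$ dimension drops and $k_1+\dots+k_{M+1}=n$. The polytope $\Delta$ is centered at the origin if this final point is the origin. In that case there is an orthogonal splitting $\mathbb{R}^n=\mathbb{R}^{k_1}\times\cdots\times\mathbb{R}^{k_{M+1}}$ such that $\Delta^{t_j}\subset\{0\}\times\mathbb{R}^{k_{j+1}}\times\cdots\times\mathbb{R}^{k_{M+1}}$ for every $j=1,\dots,M+1$. *)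

(* Defs.v *)
From HB Require Import structures.
From mathcomp Require Import all_boot all_order all_algebra.
From mathcomp Require Import all_classical all_reals all_analysis.
Set Implicit Arguments.
Unset Strict Implicit.
Unset Printing Implicit Defensive.
Import Order.TTheory GRing.Theory Num.Theory.
Import numFieldNormedType.Exports.
Local Open Scope classical_set_scope.
Local Open Scope ring_scope.

Definition dot (R : realType) (n : nat) (x y : 'rV[R]_n) : R :=
  \sum_(i < n) x 0 i * y 0 i.

(* [has_dim A m]: A is nonempty and its affine hull has dimension m.  The
   witness U is the direction of the affine hull, i.e. the smallest linear
   subspace containing all differences of points of A. *)
Definition has_dim (R : realType) (n : nat) (A : set 'rV[R]_n) (m : nat) :=
  A !=set0 /\
  exists U : {vspace 'rV[R]_n},
    [/\ \dim U = m,
        forall x y, A x -> A y -> x - y \in U &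
        forall W : {vspace 'rV[R]_n},
          (forall x y, A x -> A y -> x - y \in W) -> (U <= W)%VS].

Definition has_codim (R : realType) (n : nat) (A : set 'rV[R]_n) (c : nat) :=
  exists2 m, has_dim A m & (m + c)%N = n.

Definition intvec (R : realType) (n : nat) (w : 'rV[int]_n) : 'rV[R]_n :=
  map_mx intr w.

(* w is a primitive vector of the lattice V ∩ Z^n. *)
Definition primitive_in (R : realType) (n : nat) (V : {vspace 'rV[R]_n})
    (w : 'rV[int]_n) :=
  [/\ intvec R w \in V, w != 0 &
      forall (u : 'rV[int]_n) (m : int),
        intvec R u \in V -> w = m *: u -> `|m| = 1].

(* Half-space data (w_i, a_i, lambda_i), i < d, subject to no condition. *)
Record facet_data (R : realType) (n : nat) := FacetData {
  nfacets : nat;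
  pnormal : 'I_nfacets -> 'rV[int]_n;
  flabel : 'I_nfacets -> nat;
  offset : 'I_nfacets -> R
}.

Arguments pnormal {R n} P i : rename.
Arguments flabel {R n} P i : rename.
Arguments offset {R n} P i : rename.

(* v_i = a_i w_i *)
Definition fnormal (R : realType) (n : nat) (P : facet_data R n)
    (i : 'I_(nfacets P)) : 'rV[R]_n :=
  (flabel P i)%:R *: intvec R (pnormal P i).

Definition polytope (R : realType) (n : nat) (V : {vspace 'rV[R]_n})
    (P : facet_data R n) : set 'rV[R]_n :=
  [set x | x \in V /\ forall i, dot x (fnormal i) <= offset P i].

(* H_i^t *)
Definition hyperplane (R : realType) (n : nat) (P : facet_data R n)
    (i : 'I_(nfacets P)) (t : R) : set 'rV[R]_n :=
  [set x | dot x (fnormal i) = offset P i - t].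

Definition facet (R : realType) (n : nat) (V : {vspace 'rV[R]_n})
    (P : facet_data R n) (i : 'I_(nfacets P)) : set 'rV[R]_n :=
  polytope V P `&` hyperplane i 0.

(* P describes a labeled polytope in V, of dimension \dim V, and its indices
   enumerate the facets of that polytope without repetition or redundancy. *)
Definition labeled_polytope (R : realType) (n : nat) (V : {vspace 'rV[R]_n})
    (P : facet_data R n) :=
  [/\ forall i : 'I_(nfacets P), primitive_in V (pnormal P i) /\ (0 < flabel P i)%N,
      compact (polytope V P),
      has_dim (polytope V P) (\dim V),
      forall i : 'I_(nfacets P), has_dim (facet V i) (\dim V).-1 &
      injective (fun i : 'I_(nfacets P) => facet V i)].

Definition monotone_data (R : realType) (n : nat) (P : facet_data R n) :=
  exists lam : R, forall i : 'I_(nfacets P), offset P i = lam.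

Section Shrinking.
Variables (R : realType) (n : nat) (P : facet_data R n).

(* Times t_1, ..., t_{M+1} and sets D_1, ..., D_{M+1} are stored in functions
   on nat, with t 0 = 0; values at other indices are irrelevant. *)
Variables (M : nat) (t : nat -> R) (D : nat -> set 'I_(nfacets P)).

Definition frozen (j : nat) : set 'I_(nfacets P) :=
  [set i | exists2 s, (1 <= s <= j)%N & D s i].

(* The set Delta^r as defined by the formula used for r > t_j, once D_1, ...,
   D_j have been determined. *)
Definition shrunk (j : nat) (r : R) : set 'rV[R]_n :=
  [set x | (forall i, ~ frozen j i -> dot x (fnormal i) <= offset P i - r) /\
           (forall s i, (1 <= s <= j)%N -> D s i -> hyperplane i (t s) x)].

(* Delta^{t_j} for j >= 1: it is reached with D_1, ..., D_{j-1} frozen. *)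
Definition stage (j : nat) : set 'rV[R]_n := shrunk j.-1 (t j).

(* In [shr_before], Delta^r keeps its dimension (in particular is nonempty)
   for t_j < r < t_{j+1}, so that t_{j+1} is the smallest time after t_j at
   which the dimension drops.  No Delta^{t_j} with j <= M is a point, since
   the dimension drops again later. *)
Record shrinking (k : nat -> nat) : Prop := Shrinking {
  shr_t0 : t 0%N = 0;
  shr_lt : forall j, (j <= M)%N -> t j < t j.+1;
  shr_before : forall j r, (j <= M)%N -> t j < r < t j.+1 ->
    has_codim (shrunk j r) (\sum_(1 <= s < j.+1) k s)%N;
  shr_k : forall j, (1 <= j <= M.+1)%N -> (1 <= k j)%N;
  shr_drop : forall j, (1 <= j <= M.+1)%N ->
    has_codim (stage j) (\sum_(1 <= s < j.+1) k s)%N;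
  shr_D : forall j, (j <= M)%N ->
    D j.+1 = [set i | ~ frozen j i /\ stage j.+1 `<=` hyperplane i (t j.+1)];
  shr_end : exists p, stage M.+1 = [set p]
}.

Definition centered_at_origin := stage M.+1 = [set 0].

(* E_1, ..., E_{M+1} are the factors R^{k_1}, ..., R^{k_{M+1}}. *)
Record orthogonal_splitting (k : nat -> nat) (E : nat -> {vspace 'rV[R]_n}) :
    Prop := OrthogonalSplitting {
  spl_dim : forall j, (1 <= j <= M.+1)%N -> \dim (E j) = k j;
  spl_orth : forall i j x y, (1 <= i <= M.+1)%N -> (1 <= j <= M.+1)%N ->
    i != j -> x \in E i -> y \in E j -> dot x y = 0;
  spl_full : (\sum_(1 <= j < M.+2) E j)%VS = fullv;
  spl_stage : forall j, (1 <= j <= M.+1)%N ->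
    stage j `<=` [set x | x \in (\sum_(j.+1 <= s < M.+2) E s)%VS]
}.

End Shrinking.

(* The product A x W, with A contained in a complement of W. *)
Definition cylinder (R : realType) (n : nat) (A : set 'rV[R]_n)
    (W : {vspace 'rV[R]_n}) : set 'rV[R]_n :=
  [set z | exists x y, [/\ A x, y \in W & z = x + y]].

(* Main.v *)
Require Import Defs.
From HB Require Import structures.
From mathcomp Require Import all_boot all_order all_algebra.
From mathcomp Require Import zify lra.
From mathcomp Require Import all_classical all_reals all_analysis.
Set Implicit Arguments.
Unset Strict Implicit.
Unset Printing Implicit Defensive.
Import Order.TTheory GRing.Theory Num.Theory.
Import numFieldNormedType.Exports.
Local Open Scope classical_set_scope.
Local Open Scope ring_scope.

(** When [Delta] is centered at the origin, every offset can be read off by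
    evaluating at [0]: a facet frozen at time [t_s] has offset exactly [t_s]
    ([offset_frozen]), and a facet that is not frozen before the last drop has
    offset at least [t_{M+1}] ([offset_unfrozen]).  Write [v_i] for the normals,
    [lambda_i] for the offsets, and [L_j = E_1 + ... + E_j].

    For [j <= M], let [S_j] be cut out in [L_j] by [<x, v_i> <= t_j], for all
    facets [i] frozen by time [t_j].  All its offsets are equal, and it contains
    the projection of [Delta], since [lambda_i = t_s <= t_j] for a facet frozen
    at [t_s].  The facets frozen at [t_j] itself keep their true offset in
    [S_j], so the cylinders over the [S_j] recover all facets frozen by [t_M].
    The remaining facets are recovered in full dimension: for [mu >= t_{M+1}],
    the inequalities [<x, v_i> <= mu], over all [i] with [lambda_i <= mu], hold
    on [Delta], and [mu = lambda_i] returns the inequality of facet [i].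

    Two facts turn these systems of inequalities into labeled polytopes.

    - Compactness.  If [x] in [L_j] satisfies [<x, v_i> <= 0] for all facets
      frozen by [t_j], then [x = 0] ([recession_trivial]).  Indeed, by induction
      on the stages, moving a relative interior point of a stage slightly in
      the direction [x] stays in that stage, hence [x] is tangent to every
      stage up to the [j]-th, and so orthogonal to [L_j].  A polyhedron with
      trivial recession cone is compact ([compact_polytope]).

    - Irredundance.  Some inequalities may be superfluous, so one passes to a
      minimal set of indices defining the same polyhedron.  Because all offsets
      are equal to one positive constant, a point that violates only the [i]-th
      inequality can be scaled down into the relative interior of the [i]-th
      facet ([facet_witness]); this shows at once that the facets have the right
      dimension and are pairwise distinct ([exists_labeled_subdata]). *)

(** * The dot product and linear subspaces *)

Section Dot.
Variables (R : realType) (n : nat).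
Implicit Types (x y v : 'rV[R]_n) (V W : {vspace 'rV[R]_n}).

(** The codomain is [R^o] so that the form is a vector space morphism, with a
    kernel that is a [{vspace _}]. *)
Definition dot_with v x : R^o := dot x v.

Fact dot_with_is_linear v : linear (dot_with v).
Proof.
move=> a x y; rewrite /dot_with /dot scaler_sumr -big_split /=.
by apply: eq_bigr => i _; rewrite !mxE mulrDl -mulrA.
Qed.

HB.instance Definition _ v :=
  GRing.isLinear.Build R 'rV[R]_n R^o _ (dot_with v) (dot_with_is_linear v).

Lemma dotC x y : dot x y = dot y x.
Proof. by apply: eq_bigr => i _; rewrite mulrC. Qed.

Lemma dotDl x y v : dot (x + y) v = dot x v + dot y v.
Proof. exact: (linearD (dot_with v)). Qed.

Lemma dotBl x y v : dot (x - y) v = dot x v - dot y v.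
Proof. exact: (linearB (dot_with v)). Qed.

Lemma dotZl a x v : dot (a *: x) v = a * dot x v.
Proof.
by rewrite /dot mulr_sumr; apply: eq_bigr => i _; rewrite mxE mulrA.
Qed.

Lemma dot0l v : dot 0 v = 0.
Proof. exact: (linear0 (dot_with v)). Qed.

Lemma dot_self_eq0 x : dot x x = 0 -> x = 0.
Proof.
move=> /eqP; rewrite psumr_eq0 => [/allP x0|i _]; last first.
  by rewrite -expr2 sqr_ge0.
apply/rowP => i; rewrite mxE; apply/eqP.
by have := x0 i (mem_index_enum i); rewrite mulf_eq0 orbb.
Qed.

Definition orth v : {vspace 'rV[R]_n} := lker (linfun (dot_with v)).

Lemma memv_orth v x : (x \in orth v) = (dot x v == 0).
Proof. by rewrite memv_ker lfunE. Qed.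

Lemma dim_cap_orth V v : v \in V -> v != 0 ->
  \dim (V :&: orth v) = (\dim V).-1.
Proof.
move=> vV v0; have := limg_ker_dim (linfun (dot_with v)) V.
suff -> : (linfun (dot_with v) @: V)%VS = fullv.
  by rewrite dimvf /dim /= => <-; rewrite addn1.
apply/eqP; rewrite eqEdim subvf dimvf /dim /= lt0n dimv_eq0.
apply: contra v0 => /eqP im0; apply/eqP/dot_self_eq0.
have := memv_img (linfun (dot_with v)) vV.
by rewrite im0 memv0 lfunE => /eqP.
Qed.

Lemma continuous_sum (T : topologicalType) (U : normedModType R) (I : finType)
    (f : I -> T -> U) :
  (forall i, continuous (f i)) -> continuous (fun u => \sum_i f i u).
Proof.
move=> cf u; apply: cvg_big => [|i _]; last exact: cf.
exact: add_continuous.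
Qed.

Lemma continuous_dot v : continuous (fun x : 'rV[R]_n => dot x v).
Proof.
apply: continuous_sum => i x.
by apply: continuousM; [exact: coord_continuous|exact: cst_continuous].
Qed.

(** An endomorphism is a combination of fixed vectors whose coefficients are the
    coordinates, which are continuous. *)
Lemma continuous_lfun_rV (f : 'End('rV[R]_n)) : continuous f.
Proof.
have fE x : f x = \sum_(i < n) x 0 i *: f (delta_mx 0 i).
  rewrite [in LHS](row_sum_delta x) linear_sum.
  by apply: eq_bigr => i _; rewrite linearZ.
rewrite (funext fE); apply: continuous_sum => i x.
exact/continuousZr_tmp/coord_continuous.
Qed.

(** [V] is the zero set of the continuous map [\1 - projv V]. *)
Lemma closed_vspace V : closed [set x | x \in V].
Proof.
rewrite (_ : [set x | x \in V] = (\1 - projv V)%VF @^-1` [set 0]).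
  apply: preimage_closed => [x _|]; first exact: continuous_lfun_rV.
  exact/accessible_closed_set1/hausdorff_accessible/norm_hausdorff.
apply/seteqP; split=> x /=; rewrite add_lfunE opp_lfunE id_lfunE.
  by move=> /projv_id ->; exact: subrr.
by move=> /eqP; rewrite subr_eq0 => /eqP ->; exact: memv_proj.
Qed.

End Dot.

(** * Polyhedra with trivial recession cone *)

Section Reduction.
Variables (R : realType) (n : nat).
Implicit Types (V W U : {vspace 'rV[R]_n}) (P Q : facet_data R n).

(** Finitely many strict inequalities survive a small enough displacement: [b i]
    is the slack of the [i]-th one and [a i] its rate of consumption. *)
Lemma small_step (I : finType) (a b : I -> R) (s : {pred I}) :
  (forall i, i \in s -> 0 < b i) ->
  exists2 e : R, 0 < e & forall i, i \in s -> e * a i <= b i.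
Proof.
move=> b0; suff [e e0 eP] : exists2 e : R, 0 < e &
    forall i, i \in enum s -> e * a i <= b i.
  by exists e => // i si; apply: eP; rewrite mem_enum.
have {b0} : forall i, i \in enum s -> 0 < b i.
  by move=> i; rewrite mem_enum; exact: b0.
elim: (enum s) => [_|i l IH b0]; first by exists 1.
have [|e e0 eP] := IH; first by move=> j jl; apply: b0; rewrite inE jl orbT.
have bi0 : 0 < b i by apply: b0; rewrite mem_head.
have a1 : 0 < `|a i| + 1 by rewrite ltr_wpDl.
exists (Num.min e (b i / (`|a i| + 1))) => [|j].
  by rewrite lt_min e0 divr_gt0.
have m0 : 0 <= Num.min e (b i / (`|a i| + 1)).
  by rewrite le_min ltW //= ltW // divr_gt0.
rewrite inE => /predU1P[->|jl].
  apply: le_trans (_ : Num.min e (b i / (`|a i| + 1)) * (`|a i| + 1) <= _).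
    by apply: ler_wpM2l => //; rewrite (le_trans (ler_norm _)) // lerDl.
  by rewrite -ler_pdivlMr // ge_min lexx orbT.
have [aj0|aj0] := leP (a j) 0.
  by rewrite (le_trans (mulr_ge0_le0 m0 aj0)) // ltW // b0 // inE jl orbT.
rewrite (le_trans _ (eP j jl)) // ler_wpM2r ?(ltW aj0) //.
by rewrite ge_min lexx.
Qed.

(** If one can move within [A] from [p] in every direction of [U], then every
    subspace containing the differences of points of [A] contains [U]. *)
Lemma has_dim_local (A : set 'rV[R]_n) U p :
  A p -> (forall x y, A x -> A y -> x - y \in U) ->
  (forall u, u \in U -> exists2 e : R, 0 < e & A (p + e *: u)) ->
  has_dim A (\dim U).
Proof.
move=> Ap AU locU; split; first by exists p.
exists U; split=> // W AW; apply/subvP => u /locU[e e0 Ae].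
have := AW _ _ Ae Ap; rewrite addrC addKr => /(memvZ e^-1).
by rewrite scalerA mulVf ?scale1r // gt_eqF.
Qed.

(** The function [f x = 2 * \sum_i max (<x, v_i>, 0)], written below without the
    maximum, is positively homogeneous and bounded on the polyhedron.  It vanishes
    only on the recession cone, so on the unit sphere of [V] it has a positive
    minimum [m], and [m * `|x| <= f x] bounds the polyhedron. *)
Lemma compact_polytope V P :
  (forall x, x \in V ->
    (forall i : 'I_(nfacets P), dot x (fnormal i) <= 0) -> x = 0) ->
  compact (polytope V P).
Proof.
move=> cone0.
have closedP : closed (polytope V P).
  rewrite (_ : polytope V P = [set x | x \in V] `&`
      \bigcap_(i in [set: 'I_(nfacets P)])
        (fun x => dot x (fnormal i)) @^-1` [set r | r <= offset P i]).
    apply: closedI; first exact: closed_vspace.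
    apply: closed_bigI => i _; apply: preimage_closed; last exact: closed_le.
    by move=> x _; exact: continuous_dot.
  apply/seteqP; split=> x [xV xP]; split=> // i; first by move=> _; exact: xP.
  exact: (xP i I).
apply: bounded_closed_compact closedP.
pose f (x : 'rV[R]_n) :=
  \sum_(i < nfacets P) (`|dot x (fnormal i)| + dot x (fnormal i)).
have f_cont : continuous f.
  apply: continuous_sum => i.
  have cdot : continuous (fun x : 'rV[R]_n => dot x (fnormal i)).
    exact: continuous_dot.
  have cnorm : continuous (fun x : 'rV[R]_n => `|dot x (fnormal i)|).
    by move=> x; exact: cvg_norm (cdot x).
  by move=> x; exact: cvgD (cnorm x) (cdot x).
have f_ge0 x i : 0 <= `|dot x (fnormal i)| + dot x (fnormal i).
  by rewrite -lerBlDr sub0r -normrN ler_norm.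
have fs_ge0 x : 0 <= f x by apply: sumr_ge0 => i _; exact: f_ge0.
have f_gt0 x : x \in V -> x != 0 -> 0 < f x.
  move=> xV x0; rewrite lt0r fs_ge0 andbT.
  apply: contra x0; rewrite psumr_eq0; last by move=> i _; exact: f_ge0.
  move=> /allP fx0.
  apply/eqP; apply: cone0 => // i.
  have := fx0 i (mem_index_enum i); rewrite /= addr_eq0 => /eqP fx.
  by rewrite -oppr_ge0 -fx.
have fZ a x : 0 <= a -> f (a *: x) = a * f x.
  move=> a0; rewrite /f mulr_sumr; apply: eq_bigr => i _.
  by rewrite dotZl normrM ger0_norm // mulrDr.
pose K := [set x : 'rV[R]_n | x \in V] `&` [set x | `|x| = 1].
have compactK : compact K.
  apply: bounded_closed_compact.
    exists 1; split; first exact: num_real.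
    by move=> r r1 x [_ /= ->]; exact: ltW.
  apply: closedI; first exact: closed_vspace.
  apply: (@preimage_closed _ _ (fun x : 'rV[R]_n => `|x|) [set 1]);
    last exact: closed_eq.
  by move=> x _; exact: norm_continuous.
have [m m0 mP] : exists2 m : R, 0 < m & forall x, x \in V -> m * `|x| <= f x.
  (* The sphere is empty when [V = 0]; any [m] works then. *)
  have [K0|/set0P K0] := eqVneq K set0.
    exists 1 => // x xV; have [->|x0] := eqVneq x 0.
      by rewrite normr0 mulr0 fs_ge0.
    suff : K (`|x|^-1 *: x) by rewrite K0.
    split; first exact: memvZ.
    by rewrite /= normrZ normfV normr_id mulVf // normr_eq0.
  have [x0 /set_mem[x0V x01] fmin] :=
    @compact_EVT_min _ R f _ K0 compactK (continuous_subspaceT f_cont).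
  exists (f x0); first by apply: f_gt0 => //; rewrite -normr_eq0 x01 oner_eq0.
  move=> x xV; have [->|x_neq0] := eqVneq x 0.
    by rewrite normr0 mulr0 fs_ge0.
  have nx0 : 0 < `|x| by rewrite normr_gt0.
  rewrite -ler_pdivlMr // mulrC -fZ ?invr_ge0 //.
  apply: fmin; apply/mem_set; split; first exact: memvZ.
  by rewrite /= normrZ normfV normr_id mulVf // gt_eqF.
pose C := \sum_(i < nfacets P) (`|offset P i| + `|offset P i|).
exists (C / m); split; first exact: num_real.
move=> r Cr x [xV xP]; apply: le_trans (ltW Cr).
rewrite /= ler_pdivlMr // mulrC (le_trans (mP x xV)) //.
apply: ler_sum => i _.
have [d0|d0] := leP 0 (dot x (fnormal i)).
  by rewrite ger0_norm // lerD // (le_trans (xP i)) // ler_norm.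
by rewrite ltr0_norm // addNr addr_ge0.
Qed.


(** * Irredundant systems of inequalities with a common offset *)

Definition subdata P (B : {set 'I_(nfacets P)}) (c : R) : facet_data R n :=
  FacetData (fun j : 'I_#|B| => pnormal P (enum_val j))
            (fun j => flabel P (enum_val j)) (fun=> c).

Lemma polytope_subdata V P (B : {set 'I_(nfacets P)}) c x :
  polytope V (subdata B c) x <->
  x \in V /\ forall i, i \in B -> dot x (fnormal i) <= c.
Proof.
split=> -[xV xB]; split=> // i; last exact/xB/enum_valP.
by move=> iB; have := xB (enum_rank_in iB i); rewrite /fnormal /= enum_rankK_in.
Qed.

Definition implies_bounds V P (A B : {set 'I_(nfacets P)}) (c : R) :=
  forall x, x \in V -> (forall i, i \in B -> dot x (fnormal i) <= c) ->
    forall i, i \in A -> dot x (fnormal i) <= c.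

(** An inclusion-minimal set of indices exists by finiteness; in it, no single
    inequality follows from the others. *)
Lemma minimal_bounds V P (A : {set 'I_(nfacets P)}) c :
  exists B : {set 'I_(nfacets P)},
    [/\ B \subset A, implies_bounds V A B c &
        forall i, i \in B -> ~ implies_bounds V A (B :\ i) c].
Proof.
have pA : `[< implies_bounds V A A c >] by apply/asboolP => x xV.
have [B /minsetP[/asboolP pB minB] BA] :=
  minset_exists (P := fun B => `[< implies_bounds V A B c >]) pA.
exists B; split=> // i iB /asboolP pBi.
by have /setP/(_ i) := minB _ pBi (subsetDl _ _); rewrite !inE eqxx iB.
Qed.

(** Minimality gives a point [x] of [V] that violates the [i]-th inequality only.
    The factor [c / <x, v_i> < 1] brings it onto the [i]-th hyperplane and, since
    [c > 0], makes all the other inequalities strict. *)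
Lemma facet_witness V P (A B : {set 'I_(nfacets P)}) c i :
  0 < c -> i \in B ->
  implies_bounds V A B c -> ~ implies_bounds V A (B :\ i) c ->
  exists z, [/\ z \in V, dot z (fnormal i) = c &
                forall l, l \in B -> l != i -> dot z (fnormal l) < c].
Proof.
move=> c0 iB impB nimp.
have [x [xV xB xi]] : exists x, [/\ x \in V,
    forall l, l \in B :\ i -> dot x (fnormal l) <= c & c < dot x (fnormal i)].
  apply: contrapT => nex; apply: nimp => x xV xB.
  apply: impB => // l lB; have [->|li] := eqVneq l i; last first.
    by apply: xB; rewrite !inE li.
  by rewrite leNgt; apply/negP => xi; apply: nex; exists x.
have di0 : 0 < dot x (fnormal i) by exact: lt_trans xi.
exists ((c / dot x (fnormal i)) *: x); split=> [||l lB li]; first exact: memvZ.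
  by rewrite dotZl divfK // gt_eqF.
have s0 : 0 < c / dot x (fnormal i) by rewrite divr_gt0.
rewrite dotZl (le_lt_trans (_ : _ <= c / dot x (fnormal i) * c)) //.
  by apply: ler_wpM2l; [exact: ltW|apply: xB; rewrite !inE li].
by rewrite gtr_pMl // ltr_pdivrMr // mul1r.
Qed.

(** The polyhedron keeps its shape when [A] is cut down to a minimal subset, and
    the points of [facet_witness] give the facets of the subset their dimension and
    tell them apart. The origin is interior because [c > 0]. *)
Lemma exists_labeled_subdata V P (A : {set 'I_(nfacets P)}) c :
  0 < c ->
  (forall i, i \in A -> primitive_in V (pnormal P i) /\ (0 < flabel P i)%N) ->
  (forall x, x \in V ->
    (forall i, i \in A -> dot x (fnormal i) <= 0) -> x = 0) ->
  exists Q : facet_data R n, [/\ labeled_polytope V Q, monotone_data Q &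
    forall x, polytope V Q x <->
      x \in V /\ forall i, i \in A -> dot x (fnormal i) <= c].
Proof.
move=> c0 primA coneA; have [B [BA impB minB]] := minimal_bounds V A c.
exists (subdata B c); split; last 2 first.
- by exists c.
- move=> x; rewrite polytope_subdata; split=> -[xV xle]; split=> //.
    exact: impB.
  by move=> i /(fintype.subsetP BA); exact: xle.
have fnV (j : 'I_#|B|) : fnormal (enum_val j) \in V.
  have [[wV _ _] _] := primA _ (fintype.subsetP BA _ (enum_valP j)).
  exact: memvZ.
have fn0 (j : 'I_#|B|) : fnormal (enum_val j) != 0.
  have [[_ w0 _]] := primA _ (fintype.subsetP BA _ (enum_valP j)) => a0.
  rewrite scaler_eq0 pnatr_eq0 (gtn_eqF a0) /=; apply: contra w0 => /eqP w0.
  apply/eqP/rowP => l; have /rowP/(_ l) := w0; rewrite !mxE => /eqP.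
  by rewrite intr_eq0 => /eqP.
have wit (j : 'I_#|B|) : exists z, [/\ z \in V, dot z (fnormal (enum_val j)) = c &
    forall l, l != j -> dot z (fnormal (enum_val l)) < c].
  have jB := enum_valP j.
  have [z [zV zj zl]] := facet_witness c0 jB impB (minB _ jB).
  exists z; split=> // l lj; apply: zl; first exact: enum_valP.
  by rewrite (inj_eq enum_val_inj).
split.
- by move=> j; exact/primA/(fintype.subsetP BA)/enum_valP.
- (* A recession direction of the subsystem stays in the polyhedron when scaled
     up, so it is one of the system indexed by [A] as well. *)
  apply: compact_polytope => x xV xB; apply: coneA => // i iA.
  rewrite leNgt; apply/negP => di0.
  have xB' s : 0 < s -> s * dot x (fnormal i) <= c.
    move=> s0; rewrite -dotZl; apply: impB iA; first exact: memvZ.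
    move=> l lB; rewrite dotZl (le_trans _ (ltW c0)) // pmulr_rle0 //.
    by have := xB (enum_rank_in lB l); rewrite /fnormal /= enum_rankK_in.
  have := xB' ((c + c) / dot x (fnormal i)); rewrite divfK ?gt_eqF //.
  by rewrite leNgt ltrDl c0 => /(_ (divr_gt0 (addr_gt0 c0 c0) di0)).
- apply: (@has_dim_local _ _ 0).
  + by split=> [|j]; [exact: mem0v|rewrite dot0l ltW].
  + by move=> x y [xV _] [yV _]; exact: memvB.
  + move=> u uV; have [|e e0 eP] := @small_step _
      (fun j : 'I_#|B| => dot u (fnormal (enum_val j))) (fun=> c) predT.
      by move=> j _.
    exists e => //; rewrite add0r; split=> [|j]; first exact: memvZ.
    by rewrite dotZl; exact: eP.
- move=> j; have [z [zV zj zl]] := wit j.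
  rewrite -(dim_cap_orth (fnV j) (fn0 j)).
  apply: (@has_dim_local _ _ z).
  + split; last by rewrite /hyperplane /= subr0.
    split=> // l; have [->|lj] := eqVneq l j; first by rewrite -[leRHS]zj.
    exact/ltW/zl.
  + move=> x y [[xV _] xj] [[yV _] yj]; rewrite memv_cap memvB //= memv_orth.
    by rewrite dotBl subr_eq0 [X in X == _]xj [X in _ == X]yj.
  + move=> u; rewrite memv_cap memv_orth => /andP[uV /eqP uj].
    have [|e e0 eP] := @small_step _
      (fun l : 'I_#|B| => dot u (fnormal (enum_val l)))
      (fun l => c - dot z (fnormal (enum_val l))) (predC1 j).
      by move=> l lj; rewrite subr_gt0; exact: zl.
    have zuj : dot (z + e *: u) (fnormal (enum_val j)) = c.
      by rewrite dotDl dotZl uj mulr0 addr0.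
    exists e => //; split; last by rewrite /hyperplane /= subr0.
    split=> [|l]; first by rewrite memvD // memvZ.
    have [->|lj] := eqVneq l j; first by rewrite -[leRHS]zuj.
    by rewrite dotDl dotZl -lerBrDl; exact: eP.
- move=> j j' jj'; apply/eqP; apply/negPn/negP => neq.
  have [z [zV zj zl]] := wit j.
  have : facet V j z.
    split; last by rewrite /hyperplane /= subr0.
    split=> // l; have [->|lj] := eqVneq l j; first by rewrite -[leRHS]zj.
    exact/ltW/zl.
  move: jj' => /= -> [_]; rewrite /hyperplane /= subr0 => zj'.
  by have := zl j'; rewrite eq_sym neq [X in X < _]zj' ltxx => /(_ isT).
Qed.

End Reduction.

(** * The stages of the shrinking procedure *)

Section Shrinking.
Variables (R : realType) (n : nat) (P : facet_data R n).
Variables (M : nat) (t : nat -> R) (D : nat -> set 'I_(nfacets P)).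
Variables (k : nat -> nat) (E : nat -> {vspace 'rV[R]_n}).
Hypothesis shrinkP : shrinking M t D k.
Hypothesis centerP : centered_at_origin M t D.
Hypothesis splitE : orthogonal_splitting M t D k E.

Local Notation low j := (\sum_(1 <= s < j.+1) E s)%VS.
Local Notation high j := (\sum_(j.+1 <= s < M.+2) E s)%VS.

Lemma sum_subv a b (W : {vspace 'rV[R]_n}) :
  (forall s, (a <= s < b)%N -> (E s <= W)%VS) ->
  (\sum_(a <= s < b) E s <= W)%VS.
Proof.
move=> EW; rewrite big_nat; apply: (big_ind (fun U => (U <= W)%VS)) => //.
  exact: sub0v.
by move=> U1 U2 U1W U2W; rewrite subv_add U1W.
Qed.

Lemma low_high_full j : (j <= M.+1)%N -> (low j + high j)%VS = fullv.
Proof. by move=> jM; rewrite -big_cat_nat //= (spl_full splitE). Qed.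

Lemma low_high_orth j x y :
  (j <= M.+1)%N -> x \in low j -> y \in high j -> dot x y = 0.
Proof.
move=> jM xlow yhigh; apply/eqP; rewrite -memv_orth.
apply: subvP xlow; apply: sum_subv => s /andP[s1 sj].
apply/subvP => u uE; rewrite memv_orth dotC -memv_orth.
apply: subvP yhigh; apply: sum_subv => r /andP[rj rM].
apply/subvP => v vE; rewrite memv_orth dotC; apply/eqP.
apply: (spl_orth splitE _ _ _ uE vE); first by rewrite s1 (leq_trans _ jM).
  by rewrite (leq_trans _ rj) //= -ltnS.
by rewrite neq_ltn (leq_trans sj rj).
Qed.

(** The last stage is a point, so the drops exhaust the dimension. *)
Lemma sum_drops : (\sum_(1 <= s < M.+2) k s)%N = n.
Proof.
have [m [_ [U [<- _ minU]]] <-] := shr_drop shrinkP (j := M.+1) (leqnn _).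
suff -> : U = 0%VS by rewrite dimv0.
apply/eqP; rewrite -subv0; apply: minU => x y.
by rewrite centerP => -> ->; rewrite subrr mem0v.
Qed.

Lemma dim_sum_leq a b : (0 < a)%N -> (b <= M.+2)%N ->
  (\dim (\sum_(a <= s < b) E s)%VS <= \sum_(a <= s < b) k s)%N.
Proof.
move=> a0 bM; apply: leq_trans (dimv_leq_sum _ _ _) _.
rewrite [leqLHS]big_nat [leqRHS]big_nat leq_sum // => s /andP[sa sb].
by rewrite (spl_dim splitE) // (leq_trans a0 sa) -ltnS (leq_trans sb).
Qed.

(** Both dimensions are at most the corresponding sums of drops; their total is at
    least [n], which is the total of the sums, so both bounds are attained. *)
Lemma dim_low_high j : (j <= M.+1)%N ->
  \dim (low j) = (\sum_(1 <= s < j.+1) k s)%N /\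
  \dim (high j) = (\sum_(j.+1 <= s < M.+2) k s)%N.
Proof.
move=> jM.
have dlow := @dim_sum_leq 1 j.+1 isT jM.
have dhigh := @dim_sum_leq j.+1 M.+2 isT (leqnn _).
have := dimv_add_leqif (low j) (high j).
rewrite low_high_full // => -[+ _].
rewrite dimvf /dim /= mul1n -[leqLHS]sum_drops (big_cat_nat (n := j.+1)) //=.
lia.
Qed.

(** The splitting only says that a stage lies in the sum of the last factors. The
    dimension of the stage equals that of this sum, hence the stage spans it. *)
Lemma stage_span j (W : {vspace 'rV[R]_n}) : (1 <= j <= M.+1)%N ->
  (forall x y, stage t D j x -> stage t D j y -> x - y \in W) ->
  (high j <= W)%VS.
Proof.
move=> jM stW; have [m [_ [U [<- stU minU]]] dimU] := shr_drop shrinkP jM.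
suff -> : high j = U by exact: minU.
have /andP[_ jM'] := jM.
apply/esym/eqP; rewrite eqEdim; apply/andP; split.
  apply: minU => x y /(spl_stage splitE jM) xh /(spl_stage splitE jM) yh.
  exact: memvB.
have := sum_drops; rewrite (big_cat_nat (n := j.+1)) //= => sumk.
rewrite (dim_low_high jM').2; lia.
Qed.

Lemma frozenS j i : frozen D j i -> frozen D j.+1 i.
Proof. by move=> [s /andP[s1 sj] Ds]; exists s; rewrite // s1 leqW. Qed.

Lemma stage_sub_hyperplane s j i : (1 <= s <= j)%N -> (j <= M.+1)%N -> D s i ->
  stage t D j `<=` hyperplane i (t s).
Proof.
case: j => [|j]; first by case: s.
move=> /andP[s1]; rewrite leq_eqVlt => /predU1P[-> jM|sj jM Dsi x [_]]; last first.
  by apply=> //; rewrite s1.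
by rewrite (shr_D shrinkP) // => -[].
Qed.

(** The form [<_, v_i>] is constant on the [j]-th stage, which spans the sum of the
    last factors. *)
Lemma normal_orth_high j i y : (j <= M.+1)%N -> frozen D j i -> y \in high j ->
  dot y (fnormal i) = 0.
Proof.
move=> jM [s /andP[s1 sj] Dsi] yh; apply/eqP; rewrite -memv_orth.
apply: subvP yh; apply: stage_span; first by rewrite (leq_trans s1).
move=> p q; have sj' : (1 <= s <= j)%N by rewrite s1.
move=> /(stage_sub_hyperplane sj' jM Dsi) + /(stage_sub_hyperplane sj' jM Dsi).
by rewrite /hyperplane memv_orth dotBl /= => -> ->; rewrite subrr.
Qed.

Lemma normal_low j i : (j <= M.+1)%N -> frozen D j i -> fnormal i \in low j.
Proof.
move=> jM fi; have := memvf (fnormal i); rewrite -(low_high_full jM).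
move=> /memv_addP[a al [b bh viE]]; suff b0 : b = 0 by rewrite viE b0 addr0.
apply: dot_self_eq0; have := normal_orth_high jM fi bh.
by rewrite viE dotC dotDl (low_high_orth jM al bh) add0r.
Qed.

Lemma time_mono s j : (s <= j)%N -> (j <= M.+1)%N -> t s <= t j.
Proof.
elim: j => [|j IH]; first by rewrite leqn0 => /eqP ->.
rewrite leq_eqVlt => /predU1P[->//|sj] jM.
exact: le_trans (IH sj (ltnW jM)) (ltW (shr_lt shrinkP jM)).
Qed.

Lemma time_gt0 j : (1 <= j <= M.+1)%N -> 0 < t j.
Proof.
move=> /andP[j1 jM]; rewrite -(shr_t0 shrinkP).
exact: lt_le_trans (shr_lt shrinkP (leq0n M)) (time_mono j1 jM).
Qed.

(** The origin belongs to the last stage, which lies in all frozen hyperplanes. *)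
Lemma offset_frozen s i : (1 <= s <= M.+1)%N -> D s i -> offset P i = t s.
Proof.
move=> sM Dsi; have : hyperplane i (t s) 0.
  by apply: (stage_sub_hyperplane sM (leqnn _) Dsi); rewrite centerP.
by rewrite /hyperplane /= dot0l => /esym/eqP; rewrite subr_eq0 => /eqP.
Qed.

Lemma offset_unfrozen i : ~ frozen D M i -> t M.+1 <= offset P i.
Proof.
move=> nfi; have [/(_ i nfi)+ _] : stage t D M.+1 0 by rewrite centerP.
by rewrite dot0l subr_ge0.
Qed.

Lemma stage_midpoint j p q : stage t D j p -> stage t D j q ->
  stage t D j (2^-1 *: (p + q)).
Proof.
move=> [ple peq] [qle qeq]; split=> [i nfi|s i sj Dsi].
  have := ple i nfi; have := qle i nfi; rewrite dotZl dotDl; lra.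
have := peq s i sj Dsi; have := qeq s i sj Dsi.
rewrite /hyperplane /= dotZl dotDl; lra.
Qed.

(** A facet that is not frozen at [t_{j+1}] is strictly satisfied at some point of
    the stage; taking midpoints gives a single point that serves all facets. *)
Lemma stage_interior j : (j <= M)%N ->
  exists2 p, stage t D j.+1 p &
    forall i, ~ frozen D j.+1 i -> dot p (fnormal i) < offset P i - t j.+1.
Proof.
move=> jM; suff [p sp pP] : exists2 p, stage t D j.+1 p & forall i,
    i \in enum 'I_(nfacets P) -> ~ frozen D j.+1 i ->
    dot p (fnormal i) < offset P i - t j.+1.
  by exists p => // i; apply: pP; rewrite mem_enum.
elim: (enum _) => [|i l [p sp pP]].
  by have [m [[p sp] _] _] := shr_drop shrinkP (j := j.+1) jM; exists p.
have [fi|nfi] := pselect (frozen D j.+1 i).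
  by exists p => // a; rewrite inE => /predU1P[->|al] //; exact: pP.
have nfi' : ~ frozen D j i by move=> /frozenS.
have [q sq qi] : exists2 q, stage t D j.+1 q &
    dot q (fnormal i) < offset P i - t j.+1.
  apply: contrapT => nq; apply: nfi; exists j.+1; first by rewrite ltn0Sn /=.
  rewrite (shr_D shrinkP) //; split=> // q sq; apply/eqP.
  rewrite eq_le (sq.1 i nfi') leNgt; apply/negP => qi.
  by apply: nq; exists q.
exists (2^-1 *: (p + q)); first exact: stage_midpoint.
move=> a; rewrite dotZl dotDl inE => /predU1P[-> _|al nfa].
  have := sp.1 i nfi'; move: qi => /=; lra.
have nfa' : ~ frozen D j a by move=> /frozenS.
have := sq.1 a nfa'; have := pP a al nfa => /=; lra.
Qed.

(** Move the point [p] of [stage_interior] slightly in the direction [x]. The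
    facets frozen earlier are respected because [x] is orthogonal to their normals,
    by induction; those frozen now because [<x, v_i> <= 0]; the others because they
    have slack at [p]. So [x] is a direction of the stage. *)
Lemma recession_high j x : (j <= M.+1)%N ->
  (forall i, frozen D j i -> dot x (fnormal i) <= 0) -> x \in high j.
Proof.
elim: j => [_ _|j IH jM xle]; first by rewrite (spl_full splitE) memvf.
have xh : x \in high j by apply: IH (ltnW jM) _ => i /frozenS; exact: xle.
have [p sp pP] := stage_interior jM.
have [i /asboolP fi|e e0 eP] := @small_step _ _ (fun i => dot x (fnormal i))
    (fun i => offset P i - t j.+1 - dot p (fnormal i))
    [pred i | `[< ~ frozen D j.+1 i >]].
  by rewrite subr_gt0; exact: pP.
have spx : stage t D j.+1 (p + e *: x).
  split=> [i nfi|s i sj Dsi].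
    have [fi|nfi'] := pselect (frozen D j.+1 i).
      rewrite dotDl dotZl -[leRHS]addr0 lerD ?(sp.1 i nfi) //.
      by rewrite pmulr_rle0 // xle.
    by rewrite dotDl dotZl addrC -lerBrDr; apply: eP; exact/asboolP.
  rewrite /hyperplane /= dotDl dotZl (sp.2 s i sj Dsi).
  by rewrite (normal_orth_high (ltnW jM) _ xh) ?mulr0 ?addr0 //; exists s.
have := memvB (spl_stage splitE (j := j.+1) jM spx)
              (spl_stage splitE (j := j.+1) jM sp).
by rewrite addrC addKr => /(memvZ e^-1); rewrite scalerA mulVf ?scale1r ?gt_eqF.
Qed.

Lemma recession_trivial j x : (j <= M.+1)%N -> x \in low j ->
  (forall i, frozen D j i -> dot x (fnormal i) <= 0) -> x = 0.
Proof.
move=> jM xl /(recession_high jM) xh; apply: dot_self_eq0.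
exact: low_high_orth xl xh.
Qed.

(** * The monotone polytopes *)

(** A factorization of [w_i] in the smaller lattice is one in the whole lattice,
    and [w_i] is a multiple of [v_i], which lies in the subspace. *)
Lemma primitive_low j i : labeled_polytope fullv P ->
  (j <= M.+1)%N -> frozen D j i ->
  primitive_in (low j) (pnormal P i) /\ (0 < flabel P i)%N.
Proof.
move=> [/(_ i)[[_ w0 prim] a0] _ _ _ _] jM fi; split=> //; split=> //.
  have := normal_low jM fi => /(memvZ (flabel P i)%:R^-1).
  by rewrite scalerA mulVf ?scale1r // pnatr_eq0 (gtn_eqF a0).
by move=> u m _; apply: prim; exact: memvf.
Qed.

Lemma exists_low_polytope j : labeled_polytope fullv P -> (1 <= j <= M.+1)%N ->
  exists Q : facet_data R n, [/\ labeled_polytope (low j) Q, monotone_data Q &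
    forall x, polytope (low j) Q x <->
      x \in low j /\ forall i, frozen D j i -> dot x (fnormal i) <= t j].
Proof.
move=> labP jM; have /andP[_ jM'] := jM.
have [|i|x xl xle|Q [labQ monoQ QE]] := @exists_labeled_subdata R n (low j) P
  [set i | `[< frozen D j i >]]%SET (t j).
- exact: time_gt0.
- by rewrite finset.in_set => /asboolP; exact: primitive_low.
- apply: (recession_trivial jM' xl) => i /asboolP fi; apply: xle.
  by rewrite finset.in_set.
exists Q; split=> // x; rewrite QE; split=> -[xl xle]; split=> // i.
  by move=> /asboolP fi; apply: xle; rewrite finset.in_set.
by rewrite finset.in_set => /asboolP; exact: xle.
Qed.

(** The bound [c >= t_{M+1}] makes the system include every facet frozen by
    the end, so that the recession cone is trivial. *)
Lemma exists_full_polytope c : labeled_polytope fullv P -> t M.+1 <= c ->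
  exists Q : facet_data R n, [/\ labeled_polytope fullv Q, monotone_data Q &
    forall x, polytope fullv Q x <->
      forall i, offset P i <= c -> dot x (fnormal i) <= c].
Proof.
move=> labP tc; have tM0 : 0 < t M.+1 by apply: time_gt0; rewrite leqnn.
have [|i _|x _ xle|Q [labQ monoQ QE]] := @exists_labeled_subdata R n fullv P
  [set i | offset P i <= c]%SET c.
- exact: lt_le_trans tc.
- by case: labP => /(_ i).
- apply: (@recession_trivial M.+1) => // [|i [s sM Dsi]].
    by rewrite (spl_full splitE) memvf.
  apply: xle; rewrite finset.in_set (offset_frozen sM Dsi).
  by apply: le_trans tc; apply: time_mono => //; case/andP: sM.
exists Q; split=> // x; rewrite QE; split=> [[_ xle] i ic|xle].
  by apply: xle; rewrite finset.in_set.
by split=> [|i]; [exact: memvf|rewrite finset.in_set; exact: xle].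
Qed.

(** The normals of the system are orthogonal to the direction of the cylinder, and a
    facet frozen at [t_s] has offset [t_s <= t_j]. *)
Lemma polytope_sub_low j Q x : (1 <= j <= M.+1)%N ->
  (forall x, polytope (low j) Q x <->
      x \in low j /\ forall i, frozen D j i -> dot x (fnormal i) <= t j) ->
  polytope fullv P x -> cylinder (polytope (low j) Q) (high j) x.
Proof.
move=> /andP[j1 jM] QE [_ xP]; have := memvf x; rewrite -(low_high_full jM).
move=> /memv_addP[a al [b bh xE]]; exists a, b; split=> //.
apply/QE; split=> // i fi; case: (fi) => s /andP[s1 sj] Dsi.
have -> : dot a (fnormal i) = dot x (fnormal i).
  by rewrite xE dotDl (normal_orth_high jM fi bh) addr0.
rewrite (le_trans (xP i)) // (@offset_frozen s) ?s1 ?(leq_trans sj) //.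
exact: time_mono.
Qed.

Lemma low_cylinder_bound j i Q x : (1 <= j <= M.+1)%N -> D j i ->
  (forall x, polytope (low j) Q x <->
      x \in low j /\ forall i, frozen D j i -> dot x (fnormal i) <= t j) ->
  cylinder (polytope (low j) Q) (high j) x -> dot x (fnormal i) <= offset P i.
Proof.
move=> jM Dji QE [a [b [/QE[_ aQ] bh ->]]]; have /andP[j1 jM'] := jM.
have fi : frozen D j i by exists j; rewrite // j1 leqnn.
by rewrite dotDl (normal_orth_high jM' fi bh) addr0 (offset_frozen jM Dji) aQ.
Qed.

End Shrinking.

(** * The decomposition *)

Theorem theorem1p1 (R : realType) (n : nat) (Delta : facet_data R n)
    (hDelta : labeled_polytope fullv Delta)
    (M : nat) (t : nat -> R) (D : nat -> set 'I_(nfacets Delta))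
    (k : nat -> nat) (E : nat -> {vspace 'rV[R]_n})
    (hshrink : shrinking M t D k)
    (hcenter : centered_at_origin M t D)
    (hE : orthogonal_splitting M t D k E) :
  exists (N : nat) (T : 'I_N.+1 -> facet_data R n),
    (forall l, labeled_polytope fullv (T l) /\ monotone_data (T l)) /\
    (M = 0%N ->
       polytope fullv Delta = \bigcap_(l in [set: 'I_N.+1]) polytope fullv (T l))
    /\
    ((0 < M)%N ->
       exists S : nat -> facet_data R n,
         (forall j, (1 <= j <= M)%N ->
            [/\ labeled_polytope (\sum_(1 <= s < j.+1) E s)%VS (S j),
                \dim (\sum_(1 <= s < j.+1) E s)%VS
                  = (\sum_(1 <= s < j.+1) k s)%N &
                monotone_data (S j)]) /\
         polytope fullv Delta =
           \bigcap_(l in [set: 'I_N.+1]) polytope fullv (T l) `&`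
           \bigcap_(j in [set j | (1 <= j <= M)%N])
             cylinder (polytope (\sum_(1 <= s < j.+1) E s)%VS (S j))
                      (\sum_(j.+1 <= s < M.+2) E s)%VS).
Proof.
(* One full-dimensional polytope per facet, with common offset at least
   [t_{M+1}] and equal to that of the facet if the latter is unfrozen; the extra
   index [ord0] keeps the family nonempty. *)
pose mu (l : 'I_(nfacets Delta).+1) :=
  if unlift ord0 l is Some i then Num.max (t M.+1) (offset Delta i) else t M.+1.
have mu_ge l : t M.+1 <= mu l.
  by rewrite /mu; case: unlift => // i; rewrite le_max lexx.
have [T TP] := choice (fun l =>
  exists_full_polytope hshrink hcenter hE hDelta (mu_ge l)).
have Delta_T x : polytope fullv Delta x -> forall l, polytope fullv (T l) x.
  move=> [_ xP] l; have [_ _ TE] := TP l; apply/TE => i.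
  exact: le_trans (xP i).
have T_unfrozen x i : (forall l, polytope fullv (T l) x) -> ~ frozen D M i ->
    dot x (fnormal i) <= offset Delta i.
  move=> xT nfi; have mui : mu (lift ord0 i) = offset Delta i.
    by rewrite /mu liftK; apply: max_r; exact: offset_unfrozen hcenter i nfi.
  have [_ _ TE] := TP (lift ord0 i); rewrite mui in TE.
  by have /TE := xT (lift ord0 i); apply.
exists (nfacets Delta), T; split; first by move=> l; have [] := TP l.
split=> [M0|_].
  apply/seteqP; split=> x; first by move=> xD l _; exact: Delta_T.
  move=> xT; split=> [|i]; first exact: memvf.
  apply: T_unfrozen => [l|]; first exact: xT.
  by rewrite M0 => -[[|s]].
have /choice[S SP] j : exists Q : facet_data R n, (1 <= j <= M.+1)%N ->
    [/\ labeled_polytope (\sum_(1 <= s < j.+1) E s)%VS Q, monotone_data Q &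
      forall x, polytope (\sum_(1 <= s < j.+1) E s)%VS Q x <->
        x \in (\sum_(1 <= s < j.+1) E s)%VS /\
        forall i, frozen D j i -> dot x (fnormal i) <= t j].
  (* Outside this range the value is arbitrary. *)
  have [jM|njM] := boolP (1 <= j <= M.+1)%N; last by exists Delta.
  by have [Q QP] := exists_low_polytope hshrink hcenter hE hDelta jM; exists Q.
have leM j : (1 <= j <= M)%N -> (1 <= j <= M.+1)%N.
  by move=> /andP[-> jM]; exact: leqW.
exists S; split=> [j jM|].
  have [labS monoS _] := SP j (leM j jM); split=> //.
  have /andP[_ jM'] := leM j jM.
  by have [] := dim_low_high hshrink hcenter hE jM'.
apply/seteqP; split=> x.
  move=> xD; split=> [l _|j /leM jM]; first exact: Delta_T.
  have [_ _ SE] := SP j jM.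
  exact: (polytope_sub_low hshrink hcenter hE jM SE xD).
move=> [xT xS]; split=> [|i]; first exact: memvf.
have [[j jM Dji]|nfi] := pselect (frozen D M i); last first.
  by apply: T_unfrozen nfi => l; exact: xT.
have [_ _ SE] := SP j (leM j jM).
exact: (low_cylinder_bound hshrink hcenter hE (leM j jM) Dji SE (xS j jM)).
Qed.
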